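(* Let $c\in(0,1)$ and $a,b>0$ be constants. There is a randomized algorithm running in time $\tilde O(n^{3.5})$ and a constant $\rho>0$ (depending only on $a,b,c$) such that, on every instance $(G,U,k)$ of DS-$k$R with $|U|\ge an$, $k\ge bn$ and $k\le\min\{c|U|,\,n-|U|\}$, with high probability the algorithm outputs $C\subseteq V$ with $|C|=k$ and $d(U\triangle C)\ge\rho\cdot\max_{C'\subseteq V,|C'|=k}d(U\triangle C')$. (I.e., for $|U|=\Omega(n)$, $k=\Omega(n)$, $k\le\min\{c|U|,n-|U|\}$ there is an $\tilde O(n^{3.5})$-time SDP-based randomized $O(1)$-approximation for DS-$k$R with high probability.)
   Context: $G=(V,E,w)$ is an undirected graph with non-negative edge weights, $n=|V|$. For $S\subseteq V$, $w(E[S])$ is the total weight of edges inside $S$ and $d(S)=w(E[S])/|S|$. $A\triangle B$ is the symmetric difference. DS-$k$R: given $G$, $U\subseteq V$, $k\in\mathbb{N}$, find $C\subseteq V$ with $|C|=k$ maximizing $d(U\triangle C)$. *)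

(* Defs.v *)
From mathcomp Require Import all_boot all_order all_algebra.
From mathcomp Require Import boolp reals exp.

Set Implicit Arguments.
Unset Strict Implicit.
Unset Printing Implicit Defensive.

Import Order.TTheory GRing.Theory Num.Theory.
Local Open Scope ring_scope.

(* Finite simple undirected graphs on the vertex set 'I_n with non-negative
   edge weights: an edge is a two-element vertex set, and the values of [weight]
   outside [edges] are irrelevant. *)
Record wgraph (R : realType) (n : nat) := WGraph {
  edges : {set {set 'I_n}};
  weight : {set 'I_n} -> R;
  card_edge : forall e, e \in edges -> #|e| = 2%N;
  weight_ge0 : forall e, e \in edges -> 0 <= weight e }.

Definition inner_weight (R : realType) (n : nat) (G : wgraph R n)
    (S : {set 'I_n}) : R :=
  \sum_(e in edges G | e \subset S) weight G e.

(* The empty set gets density 0 (x / 0 = 0). *)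
Definition density (R : realType) (n : nat) (G : wgraph R n)
    (S : {set 'I_n}) : R :=
  inner_weight G S / #|S|%:R.

Definition symdiff (T : finType) (A B : {set T}) : {set T} :=
  (A :\: B) :|: (B :\: A).

(* Densities are non-negative, so the neutral element 0 does not affect the
   maximum. *)
Definition DSkR_opt (R : realType) (n : nat) (G : wgraph R n)
    (U : {set 'I_n}) (k : nat) : R :=
  \big[Num.max/0]_(C : {set 'I_n} | #|C| == k) density G (symdiff U C).

(* Computation model: a randomized real RAM.  There is an integer memory
   (natural-number cells, also used for addressing) and a real memory, both with
   indirect addressing.  Real arithmetic and comparisons have unit cost; integer
   operations have logarithmic cost, i.e. every integer (sub)expression is
   charged the bit length of its value.  Integers can be converted to reals but
   not conversely (no floor), programs contain no real constants, and the only
   source of randomness is the fair coin. *)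
Inductive iexp : Type :=
| IConst of nat
| ILoad of iexp
| IAdd of iexp & iexp
| ISub of iexp & iexp
| IMul of iexp & iexp
| IDiv of iexp & iexp.

Inductive rexp : Type :=
| RLoad of iexp
| ROfInt of iexp
| RAdd of rexp & rexp
| RSub of rexp & rexp
| RMul of rexp & rexp
| RDiv of rexp & rexp.

Inductive bexp : Type :=
| BIle of iexp & iexp
| BRle of rexp & rexp
| BNot of bexp
| BAnd of bexp & bexp.

Inductive cmd : Type :=
| CSkip
| CSetI of iexp & iexp
| CSetR of iexp & rexp
| CFlip of iexp
| CSeq of cmd & cmd
| CIf of bexp & cmd & cmd
| CWhile of bexp & cmd.

(* [coins] is the stream of coin flips not yet consumed. *)
Record state (R : realType) := State {
  imem : nat -> nat;
  rmem : nat -> R;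
  coins : nat -> bool }.

Definition upd (T : Type) (f : nat -> T) (x : nat) (v : T) : nat -> T :=
  fun y => if y == x then v else f y.

Definition set_imem (R : realType) (s : state R) (x v : nat) : state R :=
  State (upd (imem s) x v) (rmem s) (coins s).

Definition set_rmem (R : realType) (s : state R) (x : nat) (v : R) : state R :=
  State (imem s) (upd (rmem s) x v) (coins s).

Definition flip_to (R : realType) (s : state R) (x : nat) : state R :=
  State (upd (imem s) x (coins s 0%N : nat)) (rmem s) (fun i => coins s i.+1).

Definition bitlen (v : nat) : nat := (trunc_log 2 v).+1.

Fixpoint ieval (R : realType) (s : state R) (e : iexp) : nat :=
  match e with
  | IConst v => v
  | ILoad x => imem s (ieval s x)
  | IAdd e1 e2 => (ieval s e1 + ieval s e2)%N
  | ISub e1 e2 => (ieval s e1 - ieval s e2)%N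
  | IMul e1 e2 => (ieval s e1 * ieval s e2)%N
  | IDiv e1 e2 => (ieval s e1 %/ ieval s e2)%N
  end.

Fixpoint icost (R : realType) (s : state R) (e : iexp) : nat :=
  (bitlen (ieval s e) +
   match e with
   | IConst _ => 0
   | ILoad x => icost s x
   | IAdd e1 e2 | ISub e1 e2 | IMul e1 e2 | IDiv e1 e2 =>
       icost s e1 + icost s e2
   end)%N.

Fixpoint reval (R : realType) (s : state R) (e : rexp) : R :=
  match e with
  | RLoad x => rmem s (ieval s x)
  | ROfInt x => (ieval s x)%:R
  | RAdd e1 e2 => reval s e1 + reval s e2
  | RSub e1 e2 => reval s e1 - reval s e2
  | RMul e1 e2 => reval s e1 * reval s e2
  | RDiv e1 e2 => reval s e1 / reval s e2
  end.

Fixpoint rcost (R : realType) (s : state R) (e : rexp) : nat :=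
  (1 + match e with
       | RLoad x | ROfInt x => icost s x
       | RAdd e1 e2 | RSub e1 e2 | RMul e1 e2 | RDiv e1 e2 =>
           rcost s e1 + rcost s e2
       end)%N.

Fixpoint beval (R : realType) (s : state R) (e : bexp) : bool :=
  match e with
  | BIle e1 e2 => (ieval s e1 <= ieval s e2)%N
  | BRle e1 e2 => reval s e1 <= reval s e2
  | BNot e1 => ~~ beval s e1
  | BAnd e1 e2 => beval s e1 && beval s e2
  end.

Fixpoint bcost (R : realType) (s : state R) (e : bexp) : nat :=
  (1 + match e with
       | BIle e1 e2 => icost s e1 + icost s e2
       | BRle e1 e2 => rcost s e1 + rcost s e2
       | BNot e1 => bcost s e1
       | BAnd e1 e2 => bcost s e1 + bcost s e2
       end)%N.

(* [exec p s t s']: started in [s], the program [p] halts in [s'] after a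
   computation of total cost [t]. *)
Inductive exec (R : realType) : cmd -> state R -> nat -> state R -> Prop :=
| ExecSkip s :
    exec CSkip s 1%N s
| ExecSetI s x e :
    exec (CSetI x e) s (1 + icost s x + icost s e)%N
      (set_imem s (ieval s x) (ieval s e))
| ExecSetR s x e :
    exec (CSetR x e) s (1 + icost s x + rcost s e)%N
      (set_rmem s (ieval s x) (reval s e))
| ExecFlip s x :
    exec (CFlip x) s (1 + icost s x)%N (flip_to s (ieval s x))
| ExecSeq p q s t s' t' s'' :
    exec p s t s' -> exec q s' t' s'' -> exec (CSeq p q) s (t + t')%N s''
| ExecIfTrue e p q s t s' :
    beval s e -> exec p s t s' -> exec (CIf e p q) s (bcost s e + t)%N s'
| ExecIfFalse e p q s t s' :
    ~~ beval s e -> exec q s t s' -> exec (CIf e p q) s (bcost s e + t)%N s'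
| ExecWhileFalse e p s :
    ~~ beval s e -> exec (CWhile e p) s (bcost s e) s
| ExecWhileTrue e p s t s' t' s'' :
    beval s e -> exec p s t s' -> exec (CWhile e p) s' t' s'' ->
    exec (CWhile e p) s (bcost s e + t + t')%N s''.

Lemma exec_det (R : realType) (p : cmd) (s : state R) t1 s1 t2 s2 :
  exec p s t1 s1 -> exec p s t2 s2 -> t1 = t2 /\ s1 = s2.
Proof.
have absurd (e : bexp) (u : state R) : beval u e -> ~~ beval u e -> False.
  by move=> ->.
intros H; revert t2 s2; induction H; intros t2 s2 H'; inversion H'; subst;
  try (split; reflexivity);
  try (exfalso; eapply absurd; eassumption);
  repeat match goal with
  | IH : forall t s, exec ?p ?s0 t s -> _, X : exec ?p ?s0 _ _ |- _ =>
      destruct (IH _ _ X); subst; clear X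
  end; split; reflexivity.
Qed.

(* Input encoding of an instance (G, U, k).  Integer memory: cell 0 holds n,
   cell 1 holds k, cell 2 + i holds the indicator of i \in U.  Real memory: cell
   i * n + j holds the weight of the edge {i, j}, or 0 if {i, j} is not an edge.
   All other cells are 0. *)
Definition input_imem (n : nat) (U : {set 'I_n}) (k : nat) (x : nat) : nat :=
  match x with
  | 0 => n
  | 1 => k
  | y.+2 => if insub y is Some i then (i \in U : nat) else 0
  end%N.

Definition input_rmem (R : realType) (n : nat) (G : wgraph R n) (x : nat) : R :=
  match insub (x %/ n)%N, insub (x %% n)%N with
  | Some i, Some j =>
      if [set i; j] \in edges G then weight G [set i; j] else 0
  | _, _ => 0
  end.

Definition init_state (R : realType) (n : nat) (G : wgraph R n)
    (U : {set 'I_n}) (k : nat) (r : nat -> bool) : state R :=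
  State (input_imem U k) (input_rmem G) r.

(* On halting, integer cell 2 + i is non-zero iff i belongs to the output. *)
Definition output (R : realType) (n : nat) (s : state R) : {set 'I_n} :=
  [set i : 'I_n | imem s (2 + i)%N != 0%N].

(* Worst case over all feasible instances on n vertices and all coin flips. *)
Definition runs_in_time (R : realType) (p : cmd) (T : nat -> nat) : Prop :=
  forall (n : nat) (G : wgraph R n) (U : {set 'I_n}) (k : nat)
         (r : nat -> bool),
    (k <= n)%N ->
    exists (t : nat) (s : state R),
      exec p (init_state G U k r) t s /\ (t <= T n)%N.

(* f = O(g polylog) *)
Definition soft_O (R : realType) (f : nat -> nat) (g : nat -> R) : Prop :=
  exists (K : R) (d n0 : nat), forall n : nat, (n0 <= n)%N ->
    (f n)%:R <= K * g n * ln (n%:R : R) ^+ d.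

(* Probability, over m independent fair coins, that p halts with an output
   satisfying [good].  Each coin flip costs at least 1, so m coins suffice as
   soon as m bounds the running time. *)
Definition success_prob (R : realType) (p : cmd) (m : nat) (n : nat)
    (G : wgraph R n) (U : {set 'I_n}) (k : nat) (good : pred {set 'I_n}) : R :=
  #|[pred r : m.-tuple bool |
      `[< exists (t : nat) (s : state R),
            exec p (init_state G U k (nth false r)) t s /\
            good (output n s) >] ]|%:R / 2 ^+ m.

(* Main.v *)
Require Import Defs.
From mathcomp Require Import all_boot all_order all_algebra.
From mathcomp Require Import boolp reals exp.
From mathcomp Require Import zify ring lra.

Set Implicit Arguments.
Unset Strict Implicit.
Unset Printing Implicit Defensive.

Import Order.TTheory GRing.Theory Num.Theory.
Local Open Scope ring_scope.

(* Since |U| and k are linear in n and k <= c|U|, every symdiff U C with |C| = k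
   has between (1 - c) a n and n vertices, so up to a constant it suffices to
   maximize the weight inside it.  Adding vertices never loses weight, hence one
   may take C = B inside the complement of U.  Starting from B = V \ U,
   repeatedly delete from B a vertex of minimum weighted degree in U u B until
   |B| = k: by the handshake lemma one deletion keeps at least the fraction
   1 - 2/|B| of the weight, and the product telescopes, so the final weight is
   at least k(k - 1)/n^2 >= b^2/2 times the total weight when k >= 2.  This product
   vanishes for k = 1; there one peels by the degree into U instead, and the
   survivor is optimal.  This greedy rule is deterministic, takes O(n^3)
   operations on O(log n)-bit integers, and thus replaces the SDP: the success
   probability is 1. *)

(** * Syntactic cost bounds *)

Fixpoint isize (e : iexp) : nat :=
  match e with
  | IConst _ => 1
  | ILoad x => (isize x).+1
  | IAdd e1 e2 | ISub e1 e2 | IMul e1 e2 | IDiv e1 e2 =>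
      (isize e1 + isize e2).+1
  end%N.

Fixpoint rsize (e : rexp) : nat :=
  match e with
  | RLoad x | ROfInt x => (isize x).+1
  | RAdd e1 e2 | RSub e1 e2 | RMul e1 e2 | RDiv e1 e2 =>
      (rsize e1 + rsize e2).+1
  end%N.

Fixpoint bsize (e : bexp) : nat :=
  match e with
  | BIle e1 e2 => (isize e1 + isize e2).+1
  | BRle e1 e2 => (rsize e1 + rsize e2).+1
  | BNot e1 => (bsize e1).+1
  | BAnd e1 e2 => (bsize e1 + bsize e2).+1
  end%N.

(* [iub], [rub], [bub] and [cub] bound every integer that can be evaluated
   while all integer cells are at most [M]. *)
Fixpoint iub (M : nat) (e : iexp) : nat :=
  match e with
  | IConst v => v
  | ILoad x => M + iub M x
  | IAdd e1 e2 | ISub e1 e2 | IDiv e1 e2 => iub M e1 + iub M e2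
  | IMul e1 e2 => iub M e1 * iub M e2 + iub M e1 + iub M e2
  end%N.

Fixpoint rub (M : nat) (e : rexp) : nat :=
  match e with
  | RLoad x | ROfInt x => iub M x
  | RAdd e1 e2 | RSub e1 e2 | RMul e1 e2 | RDiv e1 e2 => rub M e1 + rub M e2
  end%N.

Fixpoint bub (M : nat) (e : bexp) : nat :=
  match e with
  | BIle e1 e2 => iub M e1 + iub M e2
  | BRle e1 e2 => rub M e1 + rub M e2
  | BNot e1 => bub M e1
  | BAnd e1 e2 => bub M e1 + bub M e2
  end%N.

Fixpoint cub (M : nat) (p : cmd) : nat :=
  match p with
  | CSkip => 0
  | CSetI x e => iub M x + iub M e
  | CSetR x e => iub M x + rub M e
  | CFlip x => iub M x
  | CSeq p q => cub M p + cub M q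
  | CIf e p q => bub M e + cub M p + cub M q
  | CWhile e p => bub M e + cub M p
  end%N.

(* Number of evaluated subexpressions when every loop makes at most [n]
   iterations. *)
Fixpoint csize (n : nat) (p : cmd) : nat :=
  match p with
  | CSkip => 1
  | CSetI x e => 1 + isize x + isize e
  | CSetR x e => 1 + isize x + rsize e
  | CFlip x => 1 + isize x
  | CSeq p q => csize n p + csize n q
  | CIf e p q => bsize e + csize n p + csize n q
  | CWhile e p => n * (bsize e + csize n p) + bsize e
  end%N.

Lemma bitlen_leq (u v : nat) : (u <= v)%N -> (bitlen u <= bitlen v)%N.
Proof. by move=> le_uv; rewrite /bitlen ltnS leq_trunc_log. Qed.

Section Cost.
Variables (R : realType) (M X : nat) (s : state R).
Hypothesis imem_le : forall x, (imem s x <= M)%N.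

Lemma ieval_iub (e : iexp) : (ieval s e <= iub M e)%N.
Proof.
elim: e => //= [x IH|e1 I1 e2 I2|e1 I1 e2 I2|e1 I1 e2 I2|e1 I1 e2 I2].
- by apply: leq_trans (imem_le _) (leq_addr _ _).
- exact: leq_add.
- by apply: leq_trans (leq_subr _ _) _; apply: leq_trans I1 (leq_addr _ _).
- by rewrite -addnA; apply: leq_trans (leq_mul I1 I2) (leq_addr _ _).
- by apply: leq_trans (leq_div _ _) _; apply: leq_trans I1 (leq_addr _ _).
Qed.

Lemma icost_isize (e : iexp) :
  (iub M e <= X)%N -> (icost s e <= isize e * bitlen X)%N.
Proof.
have bit (e0 : iexp) : (iub M e0 <= X)%N -> (bitlen (ieval s e0) <= bitlen X)%N.
  by move=> leX; apply: bitlen_leq; apply: leq_trans (ieval_iub e0) leX.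
elim: e => [v|x IH|e1 I1 e2 I2|e1 I1 e2 I2|e1 I1 e2 I2|e1 I1 e2 I2] leX;
  have := bit _ leX; move: leX => /= leX lebit; rewrite ?mulSn ?mulnDl;
  apply: leq_add => //.
- by apply: IH; lia.
- by apply: leq_add; [apply: I1|apply: I2]; lia.
- by apply: leq_add; [apply: I1|apply: I2]; lia.
- by apply: leq_add; [apply: I1|apply: I2]; lia.
- by apply: leq_add; [apply: I1|apply: I2]; lia.
Qed.

Lemma rcost_rsize (e : rexp) :
  (rub M e <= X)%N -> (rcost s e <= rsize e * bitlen X)%N.
Proof.
elim: e => [x|x|e1 I1 e2 I2|e1 I1 e2 I2|e1 I1 e2 I2|e1 I1 e2 I2] /= leX;
  rewrite ?mulSn ?mulnDl; apply: leq_add => //; try exact: icost_isize;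
  by apply: leq_add; [apply: I1|apply: I2]; lia.
Qed.

Lemma bcost_bsize (e : bexp) :
  (bub M e <= X)%N -> (bcost s e <= bsize e * bitlen X)%N.
Proof.
elim: e => [e1 e2|e1 e2|e1 I1|e1 I1 e2 I2] /= leX;
  rewrite ?mulSn ?mulnDl; apply: leq_add => //.
- by apply: leq_add; apply: icost_isize; lia.
- by apply: leq_add; apply: rcost_rsize; lia.
- exact: I1.
- by apply: leq_add; [apply: I1|apply: I2]; lia.
Qed.

End Cost.

(** * Hoare triples with a time bound *)

Section Hoare.
Variables (R : realType) (n M X : nat).

Definition bounded (s : state R) : Prop := forall x, (imem s x <= M)%N.

(** Total correctness with a cost bound: every evaluated subexpression has value at most [X] and so
    costs at most [bitlen X]. The premise on [cub] sits inside the triple because it passes down to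
    subprograms, whose [cub] is never larger. *)
Definition hoare (P : state R -> Prop) (p : cmd) (Q : state R -> Prop) : Prop :=
  (cub M p <= X)%N -> forall s, P s -> exists (t : nat) (s' : state R),
    [/\ exec p s t s', (t <= csize n p * bitlen X)%N & Q s'].

Lemma hoare_skip (P Q : state R -> Prop) :
  (forall s, P s -> Q s) -> hoare P CSkip Q.
Proof.
move=> PQ _ s Ps; exists 1%N, s; split; [exact: ExecSkip| |exact: PQ].
by rewrite mul1n.
Qed.

Lemma hoare_setI (P Q : state R -> Prop) (x e : iexp) :
  (forall s, P s -> bounded s) ->
  (forall s, P s -> Q (set_imem s (ieval s x) (ieval s e))) ->
  hoare P (CSetI x e) Q.
Proof.
move=> Pb PQ fit s Ps; rewrite /= in fit.
exists (1 + icost s x + icost s e)%N, (set_imem s (ieval s x) (ieval s e)).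
split; [exact: ExecSetI| |exact: PQ].
rewrite !mulnDl mul1n; apply: leq_add; first apply: leq_add => //.
  by apply: (icost_isize (Pb _ Ps)); lia.
by apply: (icost_isize (Pb _ Ps)); lia.
Qed.

Lemma hoare_setR (P Q : state R -> Prop) (x : iexp) (e : rexp) :
  (forall s, P s -> bounded s) ->
  (forall s, P s -> Q (set_rmem s (ieval s x) (reval s e))) ->
  hoare P (CSetR x e) Q.
Proof.
move=> Pb PQ fit s Ps; rewrite /= in fit.
exists (1 + icost s x + rcost s e)%N, (set_rmem s (ieval s x) (reval s e)).
split; [exact: ExecSetR| |exact: PQ].
rewrite !mulnDl mul1n; apply: leq_add; first apply: leq_add => //.
  by apply: (icost_isize (Pb _ Ps)); lia.
by apply: (rcost_rsize (Pb _ Ps)); lia.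
Qed.

Lemma hoare_seq (P Q S : state R -> Prop) (p q : cmd) :
  hoare P p Q -> hoare Q q S -> hoare P (CSeq p q) S.
Proof.
move=> hp hq fit s Ps; rewrite /= in fit.
have [|t [s1 [E1 le1 Q1]]] := hp _ s Ps; first lia.
have [|t' [s2 [E2 le2 S2]]] := hq _ s1 Q1; first lia.
exists (t + t')%N, s2; split=> //; first exact: ExecSeq E1 E2.
by rewrite mulnDl leq_add.
Qed.

Lemma hoare_if (P Q : state R -> Prop) (e : bexp) (p q : cmd) :
  (forall s, P s -> bounded s) ->
  hoare (fun s => P s /\ beval s e) p Q ->
  hoare (fun s => P s /\ ~~ beval s e) q Q ->
  hoare P (CIf e p q) Q.
Proof.
move=> Pb hp hq fit s Ps; rewrite /= in fit.
have le0 : (bcost s e <= bsize e * bitlen X)%N.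
  by apply: (bcost_bsize (Pb _ Ps)); lia.
case: (boolP (beval s e)) => Be.
  have [|t [s1 [E1 le1 Q1]]] := hp _ s (conj Ps Be); first lia.
  exists (bcost s e + t)%N, s1; split=> //; first exact: ExecIfTrue.
  rewrite !mulnDl -addnA; apply: leq_add => //.
  exact: leq_trans le1 (leq_addr _ _).
have [|t [s1 [E1 le1 Q1]]] := hq _ s (conj Ps Be); first lia.
exists (bcost s e + t)%N, s1; split=> //; first exact: ExecIfFalse.
rewrite !mulnDl -addnA; apply: leq_add => //.
exact: leq_trans le1 (leq_addl _ _).
Qed.

Lemma hoare_post (P Q Q' : state R -> Prop) (p : cmd) :
  hoare P p Q -> (forall s, Q s -> Q' s) -> hoare P p Q'.
Proof.
move=> h QQ' fit s Ps; have [t [s1 [? ? ?]]] := h fit s Ps.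
by exists t, s1; split=> //; apply: QQ'.
Qed.

(* Scratch variable [a] lives in integer cell [n + a], past the input. *)
Definition nvar : iexp := ILoad (IConst 0).
Definition addr (a : nat) : iexp := IAdd nvar (IConst a).
Definition var (a : nat) : iexp := ILoad (addr a).

Definition for_loop (a : nat) (body : cmd) : cmd :=
  CSeq (CSetI (addr a) (IConst 0))
    (CWhile (BIle (IAdd (var a) (IConst 1)) nvar)
       (CSeq body (CSetI (addr a) (IAdd (var a) (IConst 1))))).

(** The counter cell is tracked apart from [J], which must therefore survive the writes that reset
    and advance it. *)
Lemma hoare_for (J : nat -> state R -> Prop) (a : nat) (body : cmd) :
  (forall j s, J j s -> imem s 0 = n /\ bounded s) ->
  (forall j s v, J j s -> (v <= n)%N -> J j (set_imem s (n + a) v)) ->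
  (forall j, (j < n)%N ->
    hoare (fun s => J j s /\ imem s (n + a) = j) body
          (fun s => J j.+1 s /\ imem s (n + a) = j)) ->
  hoare (J 0%N) (for_loop a body) (J n).
Proof.
move=> Jok Jset hbody.
apply: (@hoare_seq _ (fun s => J 0%N s /\ imem s (n + a) = 0%N)).
  apply: hoare_setI => [s /Jok[]|s Js] //=; have [-> _] := Jok _ _ Js.
  by rewrite /upd eqxx; split=> //; apply: Jset.
set e := BIle _ _; set p := CSeq _ _ => fit s [Js sa].
have hp j : (j < n)%N -> hoare (fun s => J j s /\ imem s (n + a) = j) p
                         (fun s => J j.+1 s /\ imem s (n + a) = j.+1).
  move=> lt_jn; apply: hoare_seq (hbody j lt_jn) _.
  apply: hoare_setI => [u [/Jok[]]|u [Ju ua]] //=.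
  have [-> _] := Jok _ _ Ju; rewrite ua /upd eqxx addn1.
  by split=> //; apply: Jset.
have run m : forall j u, (j + m)%N = n -> J j u -> imem u (n + a) = j ->
    exists t u', [/\ exec (CWhile e p) u t u',
      (t <= (m * (bsize e + csize n p) + bsize e) * bitlen X)%N & J n u'].
  have leb j u : J j u -> (bcost u e <= bsize e * bitlen X)%N.
    case/Jok=> _ bu; apply: (bcost_bsize bu); move: fit => /=; lia.
  elim: m => [|m IHm] j u jm Ju ua; have [u0 bu] := Jok _ _ Ju.
    exists (bcost u e), u; rewrite addn0 in jm.
    split; [|by rewrite mul0n (leb j)|by rewrite -jm].
    by apply: ExecWhileFalse; rewrite /e /= u0 ua; lia.
  have lt_jn : (j < n)%N by lia.
  have [|t1 [u1 [E1 le1 [Ju1 u1a]]]] := hp j lt_jn _ u (conj Ju ua).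
    by move: fit => /=; lia.
  have [|t2 [u2 [E2 le2 Ju2]]] := IHm j.+1 u1 _ Ju1 u1a; first lia.
  exists (bcost u e + t1 + t2)%N, u2; split=> //.
    by apply: ExecWhileTrue E1 E2; rewrite /e /= u0 ua; lia.
  rewrite mulSn -(addnA (bsize e + _)) mulnDl; apply: leq_add => //.
  by rewrite mulnDl; apply: leq_add => //; apply: leb Ju.
exact: run (n) _ _ (add0n n) Js sa.
Qed.

End Hoare.

(** * The peeling program *)

(* Scratch variables: 2 counts rounds, 3 and 4 run over vertices, 5 counts the
   candidates seen so far in a scan, 6 is the best of them.  Real cell [n * n]
   accumulates a score and [n * n + 1] holds the score of the best candidate. *)
Definition kvar : iexp := ILoad (IConst 1).
Definition cell_addr (a : nat) : iexp := IAdd (IConst 2) (var a).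
Definition cell (a : nat) : iexp := ILoad (cell_addr a).
Definition racc : iexp := IMul nvar nvar.
Definition rbest : iexp := IAdd (IMul nvar nvar) (IConst 1).

(** The test [2 <= k + label] merges the two regimes: for [k >= 2] all of U and B is summed over,
    for [k = 1] only U. *)
Definition score_cmd : cmd :=
  CSeq (CSetR racc (ROfInt (IConst 0)))
    (for_loop 4
       (CIf (BAnd (BIle (cell 4) (IConst 1))
                  (BIle (IConst 2) (IAdd kvar (cell 4))))
          (CSetR racc (RAdd (RLoad racc)
                            (RLoad (IAdd (IMul (var 3) nvar) (var 4)))))
          CSkip)).

(** Scores are compared only from the second candidate on, so the value left in [rbest] by an
    earlier round is harmless. *)
Definition scan_cmd : cmd :=
  CSeq (CSetI (addr 5) (IConst 0))
    (for_loop 3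
       (CIf (BIle (cell 3) (IConst 0))
          (CSeq (CSetI (addr 5) (IAdd (var 5) (IConst 1)))
          (CSeq score_cmd
             (CIf (BAnd (BIle (IConst 2) (var 5))
                        (BRle (RLoad rbest) (RLoad racc)))
                CSkip
                (CSeq (CSetI (addr 6) (var 3)) (CSetR rbest (RLoad racc))))))
          CSkip)).

(** With at most [k] candidates left nothing is peeled, so a fixed number of rounds may be run. *)
Definition round_cmd : cmd :=
  CSeq scan_cmd
    (CIf (BIle (IAdd kvar (IConst 1)) (var 5))
       (CSetI (IAdd (IConst 2) (var 6)) (IConst 2))
       CSkip).

(** The last loop produces the output format: truncated subtraction from 1 sends the label 0 of
    survivors to 1 and the labels 1 and 2 to 0. *)
Definition peel_cmd : cmd :=
  CSeq (for_loop 2 round_cmd)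
    (for_loop 3 (CSetI (cell_addr 3) (ISub (IConst 1) (cell 3)))).

(** * Verification of the peeling program *)

Section Program.
Variables (R : realType) (n : nat) (G : wgraph R n) (U : {set 'I_n}) (k X : nat).
Hypothesis le_kn : (k <= n)%N.

(* During the computation cell [2 + i] is 1 on [U], 0 on the current set [B] of
   candidates, and 2 on the peeled vertices. *)
Definition label (B : {set 'I_n}) (i : 'I_n) : nat :=
  (if i \in U then 1 else if i \in B then 0 else 2)%N.

Definition scored (B : {set 'I_n}) (u : 'I_n) : bool :=
  (label B u <= 1)%N && (2 <= k + label B u)%N.

Definition pair_weight (v u : 'I_n) : R :=
  if [set v; u] \in edges G then weight G [set v; u] else 0.

Definition score (B : {set 'I_n}) (v : 'I_n) : R :=
  \sum_(u | scored B u) pair_weight v u.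

Local Notation M := (n + 2)%N.
Local Notation hoare := (hoare n M X).

Record layout (lab : 'I_n -> nat) (s : state R) : Prop := Layout {
  layout_n : imem s 0 = n;
  layout_k : imem s 1 = k;
  layout_cell : forall i : 'I_n, imem s i.+2 = lab i;
  layout_weight : forall v u : 'I_n, rmem s (v * n + u)%N = pair_weight v u;
  layout_bounded : bounded M s }.

Lemma layout_init (r : nat -> bool) :
  layout (label (~: U)) (init_state G U k r).
Proof.
split=> //= [i|v u|x]; rewrite /input_rmem.
- by rewrite valK /label in_setC; case: (i \in U).
- have n0 : (0 < n)%N by apply: leq_ltn_trans (ltn_ord v).
  by rewrite divnMDl // divn_small // addn0 modnMDl modn_small // !valK.
- case: x => [|[|y]] /=; rewrite /input_imem; [lia|lia|].
  by case: insub => [i|]; [case: (i \in U)|]; lia.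
Qed.

(** The vertex cells end at [n + 1], hence the condition [2 <= a]. *)
Lemma layout_set_scratch (lab : 'I_n -> nat) (s : state R) (a v : nat) :
  layout lab s -> (2 <= a)%N -> (v <= M)%N -> layout lab (set_imem s (n + a) v).
Proof.
move=> [s0 s1 sc sw sb] a2 vM; split=> //= [||i|x]; rewrite /= /upd.
- by case: eqP => // ?; lia.
- by case: eqP => // ?; lia.
- by have := ltn_ord i; case: eqP => [?|_ _]; [lia|apply: sc].
- by case: eqP.
Qed.

Lemma layout_set_real (lab : 'I_n -> nat) (s : state R) (a : nat) (x : R) :
  layout lab s -> layout lab (set_rmem s (n * n + a) x).
Proof.
move=> [s0 s1 sc sw sb]; split=> //= v u; rewrite /upd.
have ? := ltn_ord v; have ? := ltn_ord u.
by case: eqP => [?|_]; [nia|apply: sw].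
Qed.

Lemma layout_set_cell (lab : 'I_n -> nat) (s : state R) (j : 'I_n) (v : nat) :
  layout lab s -> (v <= 2)%N ->
  layout (fun i => if i == j then v else lab i) (set_imem s j.+2 v).
Proof.
move=> [s0 s1 sc sw sb] v2; split=> //= [i|x]; rewrite /= /upd.
- by rewrite !eqSS -val_eqE /=; case: eqP.
- by case: eqP => // _; lia.
Qed.

Lemma layout_eq (lab lab' : 'I_n -> nat) (s : state R) :
  lab =1 lab' -> layout lab s -> layout lab' s.
Proof. by move=> E [s0 s1 sc sw sb]; split=> // i; rewrite sc. Qed.

Lemma sum_ltS (P : pred 'I_n) (F : 'I_n -> R) (j : 'I_n) :
  \sum_(i : 'I_n | (i < j.+1)%N && P i) F i =
  \sum_(i : 'I_n | (i < j)%N && P i) F i + (if P j then F j else 0).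
Proof.
case: ifP => Pj; last first.
  rewrite addr0; apply: eq_bigl => i; rewrite ltnS leq_eqVlt.
  by case: eqP => [/val_inj ->|] //; rewrite Pj !andbF.
rewrite (bigD1 j) ?ltnSn ?Pj //= addrC; congr (_ + _).
apply: eq_bigl => i; rewrite ltnS [in RHS]ltn_neqAle -val_eqE /=.
by case: (_ <= _)%N; case: (P i); case: (_ == _).
Qed.

(* The part of the state that a score computation must not disturb. *)
Record scanning (B : {set 'I_n}) (t v c b : nat) (x : R) (s : state R) : Prop :=
  Scanning {
    scan_layout : layout (label B) s;
    scan_round : imem s (n + 2) = t;
    scan_vertex : imem s (n + 3) = v;
    scan_count : imem s (n + 5) = c;
    scan_best : imem s (n + 6) = b;
    scan_min : rmem s (n * n + 1) = x }.

Lemma hoare_score (B : {set 'I_n}) (t c b : nat) (x : R) (v : 'I_n) :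
  hoare (scanning B t v c b x) score_cmd
    (fun s => scanning B t v c b x s /\ rmem s (n * n) = score B v).
Proof.
pose J j s := scanning B t v c b x s /\
  rmem s (n * n) = \sum_(u : 'I_n | (u < j)%N && scored B u) pair_weight v u.
have Jlay j s : J j s -> layout (label B) s by case=> [[]].
apply: (@hoare_seq _ _ _ _ _ (J 0%N)).
  apply: hoare_setR => [s [[]]|s [lay s2 s3 s5 s6 sx]] //=.
  rewrite (layout_n lay); split; last by rewrite /= /upd eqxx big1.
  rewrite -[(n * n)%N]addn0; split=> //=; first exact: layout_set_real.
  by rewrite /upd eqn_add2l.
apply: (@hoare_post _ _ _ _ _ (J n)); last first.
  move=> s [Js sr]; split=> //; rewrite sr; apply: eq_bigl => u.
  by rewrite ltn_ord.
apply: hoare_for => [j s /Jlay[]|j s w [[lay s2 s3 s5 s6 sx] sr] wn|j ltj] //.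
  split=> //; split; rewrite /= /upd ?eqn_add2l //.
  by apply: layout_set_scratch => //; lia.
have cellE s : J j s /\ imem s (n + 4) = j ->
    ieval s (cell 4) = label B (Ordinal ltj).
  move=> [/Jlay[s0 _ sc _ _] s4]; rewrite /= s0 s4.
  exact: sc (Ordinal ltj).
apply: hoare_if => [s [/Jlay[]]||] //.
  apply: hoare_setR => [s [[/Jlay[]]]|s [Js /= be]] //.
  move: (cellE s Js) be => /= ->.
  case: Js => -[[lay s2 s3 s5 s6 sx] sr] s4.
  rewrite (layout_n lay) (layout_k lay) s3 s4 sr => be; split=> //; split.
    rewrite -[(n * n)%N]addn0; split=> //=; first exact: layout_set_real.
    by rewrite /upd eqn_add2l.
  rewrite /= /upd eqxx (sum_ltS _ _ (Ordinal ltj)) /scored be.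
  by rewrite (layout_weight lay v (Ordinal ltj)).
apply: hoare_skip => s [Js /= be].
move: (cellE s Js) be => /= ->.
case: Js => -[sc sr] s4; rewrite (layout_k (scan_layout sc)) => be.
split=> //; split=> //.
by rewrite (sum_ltS _ _ (Ordinal ltj)) /scored (negPf be) addr0.
Qed.

Definition seen (B : {set 'I_n}) (j : nat) : {set 'I_n} :=
  [set i in B | (i < j)%N].

Lemma seenS (B : {set 'I_n}) (j : 'I_n) :
  seen B j.+1 = if j \in B then j |: seen B j else seen B j.
Proof.
apply/setP=> i; case: ifP => jB; rewrite !inE ltnS leq_eqVlt.
  by rewrite -val_eqE /=; case: eqP => [/val_inj ->|]; rewrite ?jB.
by case: eqP => [/val_inj ->|]; rewrite ?jB.
Qed.

Definition min_score (B A : {set 'I_n}) (v : 'I_n) : Prop :=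
  v \in A /\ forall i, i \in A -> score B v <= score B i.

Definition scanned (B : {set 'I_n}) (t j : nat) (s : state R) : Prop :=
  [/\ layout (label B) s, imem s (n + 2) = t,
      imem s (n + 5) = #|seen B j| &
      (0 < #|seen B j|)%N -> exists v : 'I_n,
        [/\ min_score B (seen B j) v, imem s (n + 6) = v &
            rmem s (n * n + 1) = score B v] ].

Lemma card_seen (B : {set 'I_n}) (j : nat) : (#|seen B j| <= n)%N.
Proof. by rewrite -[X in (_ <= X)%N]card_ord max_card. Qed.

Lemma hoare_scan (B : {set 'I_n}) (t : nat) : B \subset ~: U ->
  hoare (fun s => layout (label B) s /\ imem s (n + 2) = t) scan_cmd
        (scanned B t n).
Proof.
move=> BU.
have lab0 i : (label B i <= 0)%N = (i \in B).
  rewrite /label; case: ifP => iU; last by case: ifP.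
  by apply/esym/negP => /(subsetP BU); rewrite in_setC iU.
apply: (@hoare_seq _ _ _ _ _ (scanned B t 0)).
  apply: hoare_setI => [s [[]]|s [lay s2]] //=; rewrite (layout_n lay) /scanned.
  have -> : seen B 0 = set0 by apply/setP=> i; rewrite !inE andbF.
  split; rewrite ?cards0 //= /upd ?eqn_add2l ?eqxx //.
  exact: layout_set_scratch.
apply: hoare_for => [j s [[]]|j s w [lay s2 s5 sv] wn|j ltj] //.
  split; rewrite //= /upd ?eqn_add2l //.
  by apply: layout_set_scratch => //; lia.
have cellE s : layout (label B) s -> imem s (n + 3) = j ->
    ieval s (cell 3) = label B (Ordinal ltj).
  by move=> [s0 _ sc _ _] s3; rewrite /= s0 s3; apply: sc (Ordinal ltj).
have SE := seenS B (Ordinal ltj); rewrite /= in SE.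
apply: hoare_if => [s [[[]]]||] //; last first.
  apply: hoare_skip => s [[[lay s2 s5 sv] s3]] /=.
  have /= -> := cellE s lay s3; rewrite lab0 => nB; rewrite (negPf nB) in SE.
  by rewrite /scanned SE.
(* The count already includes vertex [j], while the recorded best still refers to the [c] candidates
   before it. *)
pose D s := exists c b x, [/\ scanning B t j c.+1 b x s,
  Ordinal ltj \in B, c = #|seen B j| & (0 < c)%N -> exists v : 'I_n,
        [/\ min_score B (seen B j) v, b = v & x = score B v] ].
apply: (@hoare_seq _ _ _ _ _ D).
  apply: hoare_setI => [s [[[[]]]]|s [[[lay s2 s5 sv] s3]]] //=.
  have /= -> := cellE s lay s3; rewrite lab0 (layout_n lay) s5 => jB.
  exists #|seen B j|, (imem s (n + 6)), (rmem s (n * n + 1)); split=> //.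
  split=> //=; rewrite /upd ?eqn_add2l ?eqxx ?addn1 //.
  apply: layout_set_scratch => //.
  by rewrite addn2 ltnS leqW ?card_seen.
(* The existential data become fixed parameters, as [hoare_score] needs in order to say that they
   are preserved. *)
suff H (c b : nat) (x : R) : Ordinal ltj \in B -> c = #|seen B j| ->
    ((0 < c)%N -> exists v : 'I_n,
        [/\ min_score B (seen B j) v, b = v & x = score B v]) ->
    hoare (scanning B t j c.+1 b x)
      (CSeq score_cmd
         (CIf (BAnd (BIle (IConst 2) (var 5)) (BRle (RLoad rbest) (RLoad racc)))
            CSkip
            (CSeq (CSetI (addr 6) (var 3)) (CSetR rbest (RLoad racc)))))
      (fun s => scanned B t j.+1 s /\ imem s (n + 3) = j).
  by move=> fit s [c [b [x [sc jB cE hv]]]]; exact: (H c b x jB cE hv).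
move=> jB cE hv; rewrite jB in SE.
have cardS : #|seen B j.+1| = c.+1.
  by rewrite SE cardsU1 !inE ltnn andbF cE.
have jS : Ordinal ltj \in seen B j.+1 by rewrite !inE jB /=.
have /= hs := @hoare_score B t c.+1 b x (Ordinal ltj); apply: hoare_seq hs _.
apply: hoare_if => [s [[[]]]||] //.
  apply: hoare_skip => s [[[lay s2 s3 s5 s6 sx] sr] /=].
  rewrite (layout_n lay) s5 sx sr => /andP[c0 le_x]; split=> //.
  split; rewrite ?cardS // => _; have [//|v [[vS vmin] bv xv]] := hv.
  exists v; split; rewrite ?sx ?s6 //; split; rewrite SE ?in_setU1 ?vS ?orbT //.
  by move=> i; rewrite in_setU1 => /orP[/eqP ->|/vmin //]; rewrite -xv.
(* State between the two assignments recording a new best: its index is stored, its score is still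
   only in the accumulator. *)
pose E s := [/\ layout (label B) s, imem s (n + 2) = t, imem s (n + 3) = j,
  imem s (n + 5) = c.+1 /\ imem s (n + 6) = j &
  rmem s (n * n) = score B (Ordinal ltj) /\
    (forall i, i \in seen B j -> score B (Ordinal ltj) <= score B i)].
apply: (@hoare_seq _ _ _ _ _ E).
  apply: hoare_setI => [s [[[[]]]]|s [[[lay s2 s3 s5 s6 sx] sr] /=]] //.
  rewrite (layout_n lay) s3 s5 sx sr => nbe.
  split; rewrite //= /upd ?eqn_add2l ?eqxx //.
    by apply: layout_set_scratch => //; lia.
  split=> // i iS.
  (* An earlier candidate exists, so the count test succeeded and it is the score comparison that
     failed. *)
  have c0 : (0 < c)%N by rewrite cE; apply/card_gt0P; exists i.
  have [v [[vS vmin] bv xv]] := hv c0.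
  move: nbe; rewrite ltnS c0 /= -ltNge xv => /ltW lt_v.
  exact: le_trans lt_v (vmin i iS).
apply: hoare_setR => [s [[]]|s [lay s2 s3 [s5 s6] [sr smin]]] //=.
rewrite (layout_n lay) sr; split=> //; split; rewrite //= ?cardS //.
  exact: layout_set_real.
move=> _; exists (Ordinal ltj); split; rewrite /= /upd ?eqxx //.
split=> // i; rewrite SE in_setU1 => /orP[/eqP -> //|]; exact: smin.
Qed.

(** * Rounds under an abstract property preserved by peeling *)

Section Rounds.
Variable good : {set 'I_n} -> Prop.
Hypothesis good_peel : forall (B : {set 'I_n}) (v : 'I_n),
  B \subset ~: U -> good B -> (k < #|B|)%N -> min_score B B v -> good (B :\ v).
Hypothesis good_init : good (~: U).

(** At [t = n] the disjunction forces [#|B| <= k]. The matching lower bound is conditional because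
    the running time must also cover instances where the complement of U has fewer than [k]
    vertices. *)
Definition peeled (t : nat) (s : state R) : Prop :=
  exists B : {set 'I_n},
    [/\ layout (label B) s, B \subset ~: U, good B,
        (#|B| <= k)%N || (#|B| + t <= n)%N &
        (k <= #|~: U|)%N -> (k <= #|B|)%N].

Lemma hoare_round (t : nat) :
  hoare (fun s => peeled t s /\ imem s (n + 2) = t) round_cmd
        (fun s => peeled t.+1 s /\ imem s (n + 2) = t).
Proof.
suff H (B : {set 'I_n}) : B \subset ~: U -> good B ->
    (#|B| <= k)%N || (#|B| + t <= n)%N ->
    ((k <= #|~: U|)%N -> (k <= #|B|)%N) ->
    hoare (fun s => layout (label B) s /\ imem s (n + 2) = t) round_cmd
          (fun s => peeled t.+1 s /\ imem s (n + 2) = t).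
  by move=> fit s [[B [lay BU gB le1 le2]] s2]; exact: (H B).
move=> BU gB le1 le2.
have seenn : seen B n = B by apply/setP=> i; rewrite !inE ltn_ord andbT.
apply: hoare_seq (@hoare_scan B t BU) _.
apply: hoare_if => [s [[]]||] //; last first.
  apply: hoare_skip => s [[lay s2 s5 _] /=].
  rewrite (layout_k lay) (layout_n lay) s5 seenn addn1 -leqNgt => leB.
  by split=> //; exists B; split=> //; rewrite leB.
apply: hoare_setI => [s [[[]]]|s [[lay s2 s5 sv] /=]] //.
rewrite (layout_k lay) (layout_n lay) s5 seenn addn1 => ltB.
have [|v [mv s6 _]] := sv; rewrite ?seenn; first lia.
rewrite seenn in mv; rewrite s6; have vB := mv.1.
have cardB : #|B| = #|B :\ v|.+1 by rewrite (cardsD1 v B) vB.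
split; last first.
  by rewrite /upd; case: eqP => // ?; have := ltn_ord v; lia.
exists (B :\ v); split.
- apply: layout_eq (layout_set_cell v lay (leqnn 2)) => i.
  rewrite /label in_setD1; case: eqP => [->|] //=.
  by have := subsetP BU v vB; rewrite in_setC => /negPf ->.
- exact: subset_trans (subD1set _ _) BU.
- exact: good_peel.
- by lia.
- by lia.
Qed.

Lemma hoare_peel (r : nat -> bool) :
  hoare (eq (init_state G U k r)) peel_cmd
    (fun s => exists B : {set 'I_n},
       [/\ output n s = B, B \subset ~: U, good B &
           (k <= #|~: U|)%N -> #|B| = k]).
Proof.
apply: (@hoare_seq _ _ _ _ _ (peeled n)).
  move=> fit s es; apply: (@hoare_for _ _ _ _ peeled _ _ _ _ _ fit).
  - by move=> j u [B [[]]].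
  - move=> j u v [B [lay ? ? ? ?]] vn; exists B; split=> //.
    by apply: layout_set_scratch => //; lia.
  - by move=> j _; apply: hoare_round.
  rewrite -es; exists (~: U); split=> //; first exact: layout_init.
  by rewrite addn0; apply/orP; right; rewrite -[leqRHS]card_ord max_card.
move=> fit s [B [lay BU gB le1 le2]].
have cB : (k <= #|~: U|)%N -> #|B| = k by lia.
pose J j := layout (fun i => if (i < j)%N then i \in B : nat else label B i).
have hf : hoare (J 0%N)
    (for_loop 3 (CSetI (cell_addr 3) (ISub (IConst 1) (cell 3)))) (J n).
  apply: hoare_for => [j u []|j u v lay' vn|j ltj] //.
    by apply: layout_set_scratch => //; lia.
  apply: hoare_setI => [u [[]]|u [lay' u3]] //=.
  have uc := layout_cell lay' (Ordinal ltj); rewrite /= in uc.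
  rewrite (layout_n lay') u3 uc ltnn; split; last first.
    by rewrite /upd; case: eqP => // ?; lia.
  have le2' : (1 - label B (Ordinal ltj) <= 2)%N by lia.
  apply: layout_eq (layout_set_cell (Ordinal ltj) lay' le2') => i.
  rewrite ltnS -val_eqE /= [(i <= j)%N]leq_eqVlt.
  case: eqP => [e|] //=; have -> : Ordinal ltj = i by apply: val_inj.
  rewrite /label; case: ifP => iU; last by case: ifP.
  by case: (boolP (i \in B)) => // /(subsetP BU); rewrite in_setC iU.
have [t [s' [E lt Js]]] := hf fit s lay.
exists t, s'; split=> //; exists B; split=> //.
apply/setP=> i; rewrite inE (layout_cell Js) ltn_ord.
by case: (i \in B).
Qed.

End Rounds.
End Program.

(** * Weighted degrees *)

Section Degree.
Variables (R : realType) (n : nat) (G : wgraph R n).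
Implicit Types (S A B U : {set 'I_n}) (u v : 'I_n).

Definition degree S v : R :=
  \sum_(e in edges G | (e \subset S) && (v \in e)) weight G e.

Lemma inner_weight_ge0 S : 0 <= inner_weight G S.
Proof. by apply: sumr_ge0 => e /andP[eG _]; apply: weight_ge0. Qed.

Lemma inner_weightD1 S v : inner_weight G S = degree S v + inner_weight G (S :\ v).
Proof.
rewrite /inner_weight (bigID (fun e : {set 'I_n} => v \in e)) /=.
congr (_ + _); apply: eq_bigl => e; rewrite -andbA //.
by rewrite subsetD1.
Qed.

Lemma inner_weight_subset A B :
  A \subset B -> inner_weight G A <= inner_weight G B.
Proof.
move=> AB; rewrite /inner_weight [leRHS](bigID (fun e : {set 'I_n} => e \subset A)) /=.
rewrite [X in _ <= X + _](eq_bigl (fun e => (e \in edges G) && (e \subset A))); last first.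
  move=> e; rewrite -andbA; congr (_ && _).
  by case: (boolP (e \subset A)) => [/subset_trans->|]; rewrite ?andbF.
by rewrite lerDl; apply: sumr_ge0 => e /andP[/andP[eG _] _]; apply: weight_ge0.
Qed.

(** The map [u |-> [set v; u]] is injective and matches the neighbours of [v] in [S] with the edges
    of [S] at [v]. This links the sum over vertices computed by the program to a sum over edges. *)
Lemma degreeE S v : v \in S -> degree S v = \sum_(u in S) pair_weight G v u.
Proof.
move=> vS.
have inj : injective (fun u => [set v; u]).
  move=> u u' /setP E; move: (E u) (E u'); rewrite !inE !eqxx !orbT.
  by move=> /esym/orP[/eqP->|/eqP//] /orP[/eqP->|/eqP->].
rewrite /pair_weight -big_mkcondr /=.
rewrite -(big_imset (weight G) (h := fun u => [set v; u])); last exact: in2W.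
apply: eq_bigl => e; apply/idP/imsetP => [/and3P[eG eS ve]|[u]]; last first.
  by move=> /andP[uS uG] ->; rewrite uG set21 subUset !sub1set vS uS.
have /eqP/cards2P[x [y [xy exy]]] := card_edge eG.
have [w ew] : exists w, e = [set v; w].
  move: ve; rewrite exy !inE => /orP[]/eqP->; first by exists y.
  by exists x; rewrite setUC.
exists w => //; apply/andP; split; last by rewrite -ew.
by apply: (subsetP eS); rewrite ew set22.
Qed.

Lemma handshake S : \sum_(v in S) degree S v = 2 * inner_weight G S.
Proof.
rewrite /degree /inner_weight mulr_sumr (exchange_big_dep
  (fun e : {set 'I_n} => (e \in edges G) && (e \subset S))) /=; last first.
  by move=> v e _ /and3P[-> ->].
apply: eq_bigr => e /andP[eG eS].
rewrite (eq_bigl (fun v => v \in e)); last first.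
  by move=> v; rewrite eG eS /= andb_idl // => /(subsetP eS).
by rewrite sumr_const (card_edge eG) mulr_natl.
Qed.

(* Averaging [handshake] over [B]: a vertex of [B] of minimum degree carries at
   most the fraction [2 / #|B|] of the weight. *)
Lemma min_degree_le S B v : B \subset S -> v \in B ->
  (forall u, u \in B -> degree S v <= degree S u) ->
  #|B|%:R * degree S v <= 2 * inner_weight G S.
Proof.
move=> BS vB vmin; rewrite -handshake mulr_natl -sumr_const.
apply: le_trans (ler_sum _ vmin) _.
rewrite [leRHS](big_setID B) /= (setIidPr BS) lerDl.
apply: sumr_ge0 => u _; apply: sumr_ge0 => e /andP[eG _].
exact: weight_ge0.
Qed.

End Degree.

(** * Weight kept by peeling *)

Section Peeling.
Variables (R : realType) (n : nat) (G : wgraph R n) (U : {set 'I_n}).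
Implicit Types (B C : {set 'I_n}).

Lemma symdiff_disjoint B : B \subset ~: U -> symdiff U B = U :|: B.
Proof.
move=> BU; apply/setP=> i; rewrite !inE.
case: (boolP (i \in B)) => [/(subsetP BU)|]; last by rewrite andbF.
by rewrite in_setC => ->; rewrite !orbT.
Qed.

Lemma score_deg (k : nat) B v : (1 < k)%N -> B \subset ~: U -> v \in B ->
  score G U k B v = degree G (U :|: B) v.
Proof.
move=> k1 BU vB; rewrite degreeE ?in_setU ?vB ?orbT //.
apply: eq_bigl => u; rewrite /scored /label in_setU.
by case: (u \in U) => /=; [lia|case: (u \in B) => /=; lia].
Qed.

(** With m = |B|, a deletion keeps at least the fraction 1 - 2/m = (m-1)(m-2) / (m(m-1)) of the
    weight. The factor m(m-1) in the invariant is this product telescoped. *)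
Lemma peel_good (k : nat) B v : (1 < k)%N -> B \subset ~: U ->
  #|B|%:R * (#|B|%:R - 1) * inner_weight G setT
    <= n%:R ^+ 2 * inner_weight G (U :|: B) ->
  (k < #|B|)%N -> min_score G U k B B v ->
  #|B :\ v|%:R * (#|B :\ v|%:R - 1) * inner_weight G setT
    <= n%:R ^+ 2 * inner_weight G (U :|: B :\ v).
Proof.
move=> k1 BU gB ltkB [vB vmin].
have vU : v \notin U by have := subsetP BU v vB; rewrite in_setC.
have lem : #|B|%:R * degree G (U :|: B) v <= 2 * inner_weight G (U :|: B).
  apply: min_degree_le (subsetUr _ _) (vB) _ => u uB.
  by rewrite -(score_deg k1 BU vB) -(score_deg k1 BU uB); apply: vmin.
have -> : U :|: B :\ v = (U :|: B) :\ v.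
  apply/setP=> i; rewrite !inE andb_orr; congr (_ || _).
  by case: eqP => // ->; rewrite (negPf vU).
have -> : #|B :\ v|%:R = #|B|%:R - 1 :> R.
  by rewrite (cardsD1 v B) vB add1n -natr1 addrK.
move: gB lem; rewrite (inner_weightD1 G (U :|: B) v).
set m : R := #|B|%:R; set W := inner_weight G setT.
set d := degree _ _ _; set f := inner_weight _ _.
have m3 : 3 <= m by rewrite ler_nat; lia.
move=> gB lem.
have -> : m - 1 - 1 = m - 2 by ring.
rewrite -(ler_pM2l (_ : 0 < m)); last lra.
have W0 : 0 <= W := inner_weight_ge0 _ _.
have := ler_wpM2l (_ : 0 <= m - 2) gB; move/(_ ltac:(lra)) => gB'.
have := ler_wpM2l (sqr_ge0 n%:R) lem => lem'.
have -> : m * ((m - 1) * (m - 2) * W) = (m - 2) * (m * (m - 1) * W) by ring.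
apply: le_trans gB' _; rewrite -subr_ge0.
(* The gap is [n%:R ^+ 2] times the slack [2 * (d + f) - m * d] of the averaging bound. *)
have -> : m * (n%:R ^+ 2 * f) - (m - 2) * (n%:R ^+ 2 * (d + f)) =
  n%:R ^+ 2 * (2 * (d + f)) - n%:R ^+ 2 * (m * d) by ring.
by rewrite subr_ge0.
Qed.

(* With [k = 1] only the edges towards [U] matter, and [score] ignores [B]. *)
Lemma score1 B v : score G U 1 B v = \sum_(u in U) pair_weight G v u.
Proof.
apply: eq_bigl => u; rewrite /scored /label.
by case: (u \in U) => //=; case: (u \in B).
Qed.

Lemma inner_weightU1 v : v \notin U ->
  inner_weight G (v |: U) = inner_weight G U + \sum_(u in U) pair_weight G v u.
Proof.
move=> vU; rewrite (inner_weightD1 G _ v) setU1K // addrC; congr (_ + _).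
rewrite degreeE ?setU11 // big_setU1 //= /pair_weight setUid.
case: ifP => [/card_edge|_]; last by rewrite add0r.
by rewrite cards1.
Qed.

Lemma hoare_peel_approx (k X : nat) (b : R) (r : nat -> bool) :
  (0 < n)%N -> (k <= n)%N -> 0 < b -> b * n%:R <= k%:R -> (k <= n - #|U|)%N ->
  hoare n (n + 2) X (eq (init_state G U k r)) peel_cmd (fun s =>
    #|output n s| = k /\
    forall C, #|C| = k -> b ^+ 2 / 2 * inner_weight G (symdiff U C) <=
                          inner_weight G (symdiff U (output n s))).
Proof.
move=> n0 le_kn b0 le_bk le_kU.
have n0R : 0 < n%:R :> R by rewrite ltr0n.
have leC : (k <= #|~: U|)%N by rewrite cardsCs setCK card_ord.
have k0 : (0 < k)%N by rewrite -(ltr0n R); apply: lt_le_trans le_bk; apply: mulr_gt0.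
have b1 : b <= 1.
  rewrite -(ler_pM2r n0R) mul1r (le_trans le_bk) // ler_nat //.
have [k1|k1] := leqP k 1; last first.
  apply: hoare_post (@hoare_peel _ _ G U k X le_kn _
    (fun B v BU gB => peel_good k1 BU gB) _ r) _.
    have -> : U :|: ~: U = setT by rewrite setUCr.
    apply: ler_wpM2r; first exact: inner_weight_ge0.
    have : (#|~: U| <= n)%N by rewrite -[leqRHS]card_ord max_card.
    rewrite -(ler_nat R); set x := _%:R => lexn.
    have : 0 <= x by rewrite ler0n.
    nra.
  move=> s [B [-> BU gB /(_ leC) cB]]; split=> // C _.
  rewrite (symdiff_disjoint BU).
  apply: (@le_trans _ _ (b ^+ 2 / 2 * inner_weight G setT)).
    apply: ler_wpM2l; first by rewrite divr_ge0 ?sqr_ge0.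
    exact/inner_weight_subset/subsetT.
  rewrite -(ler_pM2l (exprn_gt0 2 n0R)); apply: le_trans gB; rewrite cB mulrA.
  apply: ler_wpM2r; first exact: inner_weight_ge0.
  (* Here n^2 b^2/2 <= k^2/2 <= k(k-1), the last inequality because k >= 2. *)
  have k2 : 2 <= k%:R :> R by rewrite ler_nat.
  have : (b * n%:R) ^+ 2 <= k%:R ^+ 2.
    by rewrite lerXn2r ?nnegrE ?ler0n // mulr_ge0 // ltW.
  rewrite exprMn; set y := b ^+ 2; set z := n%:R ^+ 2; nra.
have {k0 k1} k1 : k = 1%N by lia.
rewrite {}k1 in le_kn leC *.
pose dU v := \sum_(u in U) pair_weight G v u.
(* [B] always retains a vertex whose degree into U is maximum over the complement of U. *)
pose good B := forall v, v \notin U -> exists2 u, u \in B & dU v <= dU u.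
apply: hoare_post (@hoare_peel _ _ G U 1 X le_kn good _ _ r) _.
- move=> B v BU gB cB [vB vmin] w wU; have [u uB le_wu] := gB w wU.
  have [uv|uv] := eqVneq u v; last by exists u => //; rewrite in_setD1 uv.
  (* If the deleted vertex was the witness, any remaining [x] replaces it: the deleted score was
     minimum. *)
  have /card_gt0P[x] : (0 < #|B :\ v|)%N by move: cB; rewrite (cardsD1 v B) vB.
  rewrite in_setD1 => /andP[xv xB]; exists x; first by rewrite in_setD1 xv.
  by apply: le_trans le_wu _; rewrite uv; have := vmin x xB; rewrite !score1.
- by move=> v vU; exists v; rewrite ?in_setC.
move=> s [B [-> BU gB /(_ leC) /eqP cB]]; split; first exact/eqP.
case/cards1P: cB => x Bx; rewrite (symdiff_disjoint BU) Bx setUC.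
have xU : x \notin U by have := subsetP BU x; rewrite Bx set11 in_setC; apply.
move=> C /eqP/cards1P[y ->].
have b2 : b ^+ 2 / 2 <= 1 by nra.
apply: le_trans (ler_piMl (inner_weight_ge0 _ _) b2) _.
(* Toggling [y] in U only shrinks U; toggling [y] outside U adds exactly [dU y], which is at most
   [dU x]. *)
have [yU|yU] := boolP (y \in U).
  apply: inner_weight_subset; apply/subsetP=> i; rewrite !inE.
  case/orP=> [/andP[_ ->]|/andP[iU /eqP e]]; first by rewrite orbT.
  by rewrite e yU in iU.
rewrite symdiff_disjoint ?sub1set ?in_setC // setUC !inner_weightU1 // lerD2l.
by have [u] := gB y yU; rewrite Bx in_set1 => /eqP ->.
Qed.

End Peeling.

(** * Running time of the peeling program *)

Definition peel_time (n : nat) : nat :=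
  (csize n peel_cmd * bitlen (cub (n + 2) peel_cmd))%N.

Lemma csize_peel (n : nat) : (0 < n)%N -> (csize n peel_cmd <= 328 * n ^ 3)%N.
Proof.
move=> n0.
have -> : csize n peel_cmd = (75 * n ^ 3 + 117 * n ^ 2 + 104 * n + 32)%N.
  by rewrite /= !expnS expn0; lia.
(* The constant is 328 = 75 + 117 + 104 + 32, all powers being at most n^3. *)
by rewrite !expnS expn0 !muln1; nia.
Qed.

Lemma cub_peel (n : nat) : (100 <= n)%N -> (cub (n + 2) peel_cmd <= n ^ 4)%N.
Proof.
move=> n100.
have -> : cub (n + 2) peel_cmd =
    (9 * (n + 2) * (n + 2) + 79 * (n + 2) + 146)%N by rewrite /=; lia.
have n2 : (100 * n <= n * n)%N by rewrite leq_mul2r n100 orbT.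
have : (1000 * (n * n) <= n * n * (n * n))%N.
  by rewrite leq_mul2r; apply/orP; right; lia.
by rewrite !expnS expn0 muln1; lia.
Qed.

(** The bit length is at most log_2 v + 1 for v > 0. Here log_2 v <= d log_2 n, and [2 <= n] absorbs
    the 1 into one more log_2 n. *)
Lemma bitlen_ln (R : realType) (v n d : nat) :
  (2 <= n)%N -> (v <= n ^ d)%N ->
  (bitlen v)%:R <= d.+1%:R / ln 2 * ln (n%:R : R).
Proof.
move=> n2 vn.
have ln2 : 0 < ln 2 :> R by rewrite ln_gt0 // ltr1n.
have lnn : ln 2 <= ln n%:R :> R by rewrite ler_ln ?posrE ?ltr0n ?ler_nat //; lia.
rewrite mulrAC ler_pdivlMr // /bitlen -natr1 -[d.+1%:R]natr1 !mulrDl !mul1r.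
apply: lerD => //; case: v vn => [|v] vn.
  by rewrite trunc_log0 mul0r mulr_ge0 ?ler0n // (le_trans (ltW ln2)).
rewrite !mulr_natl -!lnXn ?ltr0n //; last lia.
rewrite -!natrX ler_ln ?posrE ?ltr0n ?expn_gt0 //; last by lia.
by rewrite ler_nat (leq_trans _ vn) // trunc_logP.
Qed.

Lemma peel_time_soft_O (R : realType) :
  soft_O peel_time (fun n : nat => (n%:R : R) `^ (7 / 2)).
Proof.
(* 328 comes from [csize_peel]; 5 = 4 + 1 from [bitlen_ln] at the exponent 4 of [cub_peel], which
   also gives the threshold 100. *)
exists (328%:R * (5%:R / ln 2)), 1%N, 100%N => n n100.
have ln2 : 0 < ln 2 :> R by rewrite ln_gt0 // ltr1n.
have n1 : 1 <= n%:R :> R by rewrite ler1n; lia.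
rewrite /peel_time natrM expr1.
apply: (@le_trans _ _ ((328 * n ^ 3)%:R * (5%:R / ln 2 * ln (n%:R : R)))).
  apply: ler_pM; rewrite ?ler0n // ?ler_nat.
    by apply: csize_peel; lia.
  by apply: bitlen_ln; [lia|apply: cub_peel].
rewrite natrM natrX.
have -> : 328%:R * n%:R ^+ 3 * (5%:R / ln 2 * ln (n%:R : R)) =
  328%:R * (5%:R / ln 2) * n%:R ^+ 3 * ln n%:R by ring.
apply: ler_wpM2r; first exact: ln_ge0.
apply: ler_wpM2l.
  by rewrite mulr_ge0 ?ler0n // divr_ge0 ?ler0n // ltW.
rewrite -powR_mulrn; last lra.
by apply: ler_powR => //; lra.
Qed.

Lemma peel_runs_in_time (R : realType) : runs_in_time R peel_cmd peel_time.
Proof.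
move=> n G U k r le_kn.
(* Only the cost is wanted, so the tracked property is trivial. *)
have [] // := @hoare_peel R n G U k (cub (n + 2) peel_cmd) le_kn
  (fun=> True) _ _ r (leqnn _) _ erefl.
by move=> t [s [E le_t _]]; exists t, s.
Qed.

(** * From weights to the approximation guarantee *)

Lemma success_prob1 (R : realType) (p : cmd) (m n : nat) (G : wgraph R n)
    (U : {set 'I_n}) (k : nat) (good : pred {set 'I_n}) :
  (forall r, exists t s, exec p (init_state G U k r) t s /\ good (output n s)) ->
  success_prob p m G U k good = 1.
Proof.
move=> H; rewrite /success_prob eq_cardT => [|r]; last first.
  by rewrite inE; apply/asboolP; apply: H.
by rewrite -cardT card_tuple card_bool natrX divff // expf_neq0 // pnatr_eq0.
Qed.

Lemma card_symdiff_ge (n : nat) (U C : {set 'I_n}) :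
  (#|U| - #|C| <= #|symdiff U C|)%N.
Proof.
apply: leq_trans (subset_leq_card (subsetUl _ _)).
by rewrite cardsD leq_sub2l // subset_leq_card // subsetIr.
Qed.

(** Since [#|S'| <= n] and [#|S|] is at least [(1 - c) * a * n], passing from weights to densities
    costs only the factor [(1 - c) * a]. *)
Lemma density_approx (R : realType) (n : nat) (G : wgraph R n) (a c x : R)
    (S S' : {set 'I_n}) :
  0 < (1 - c) * a -> (0 < n)%N -> 0 <= x -> (0 < #|S'|)%N ->
  (1 - c) * a * n%:R <= #|S|%:R ->
  x * inner_weight G S <= inner_weight G S' ->
  (1 - c) * a * x * density G S <= density G S'.
Proof.
move=> ca0 n0 x0 S'0 leS leW; set y := (1 - c) * a in ca0 leS *.
have n0R : 0 < n%:R :> R by rewrite ltr0n.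
have S0 : 0 < #|S|%:R :> R by apply: lt_le_trans leS; apply: mulr_gt0.
have W0 := inner_weight_ge0 G S; have W0' := inner_weight_ge0 G S'.
apply: (@le_trans _ _ (inner_weight G S' / n%:R)).
  rewrite /density mulrA ler_pdivrMr // [leRHS]mulrAC ler_pdivlMr //.
  apply: (@le_trans _ _ (inner_weight G S' * (y * n%:R))); last exact: ler_wpM2l.
  have -> : y * x * inner_weight G S * n%:R =
    x * inner_weight G S * (y * n%:R) by ring.
  by apply: ler_wpM2r => //; rewrite mulr_ge0 // ltW.
apply: ler_wpM2l => //.
by rewrite lef_pV2 ?posrE ?ltr0n // ler_nat -[leqRHS]card_ord max_card.
Qed.

Theorem theorem3 (R : realType) (a b c : R)
    (ha : 0 < a) (hb : 0 < b) (hc : 0 < c < 1) :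
  exists rho : R, 0 < rho /\
    forall gamma : nat, exists (p : cmd) (T : nat -> nat),
      [/\ soft_O T (fun n : nat => (n%:R : R) `^ (7 / 2)),
          runs_in_time R p T &
          forall (n : nat) (G : wgraph R n) (U : {set 'I_n}) (k : nat),
            a * n%:R <= #|U|%:R ->
            b * n%:R <= k%:R ->
            k%:R <= c * #|U|%:R ->
            (k <= n - #|U|)%N ->
            1 - (n%:R ^+ gamma)^-1 <=
              success_prob p (T n) G U k
                (fun C : {set 'I_n} =>
                   (#|C| == k) &&
                   (rho * DSkR_opt G U k <= density G (symdiff U C)))].
Proof.
have [c0 c1] := andP hc; have ca0 : 0 < (1 - c) * a by apply: mulr_gt0; lra.
(* The factor [(1 - c) * a] pays for the differing set sizes, [b ^+ 2 / 2] for the weight lost by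
   peeling. *)
exists ((1 - c) * a * (b ^+ 2 / 2)); split.
  by rewrite mulr_gt0 // divr_gt0 // exprn_gt0.
move=> gamma; exists peel_cmd, peel_time.
split; [exact: peel_time_soft_O|exact: peel_runs_in_time|].
move=> n G U k le_aU le_bk le_kU le_kn'.
have le_kn : (k <= n)%N by lia.
rewrite success_prob1 => [|r]; first by rewrite lerBlDr lerDl invr_ge0 exprn_ge0.
(* Without vertices all densities and the optimum are 0. *)
have [n0|n0] := posnP n.
  have [t [s [E _]]] := peel_runs_in_time G U r le_kn.
  have card0 (A : {set 'I_n}) : #|A| = 0%N.
    by apply/eqP; rewrite -leqn0 -[leqRHS]n0 -[leqRHS]card_ord max_card.
  exists t, s; split=> //; rewrite card0 /density !card0 invr0 mulr0.
  apply/andP; split; first by apply/eqP; lia.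
  have -> : DSkR_opt G U k = 0; last by rewrite mulr0.
  apply: big1_idem => [|C _]; first exact: maxxx.
  by rewrite /density card0 invr0 mulr0.
have [t [s [E _ [ck leW]]]] := @hoare_peel_approx R n G U k
  (cub (n + 2) peel_cmd) b r n0 le_kn hb le_bk le_kn' (leqnn _) _ erefl.
exists t, s; split=> //; rewrite ck eqxx /=.
have n0R : 0 < n%:R :> R by rewrite ltr0n.
have leS (C : {set 'I_n}) : #|C| = k ->
    (1 - c) * a * n%:R <= #|symdiff U C|%:R.
  move=> cC; have := card_symdiff_ge U C; rewrite cC leq_subLR -(ler_nat R) natrD.
  have : (1 - c) * (a * n%:R) <= (1 - c) * #|U|%:R by apply: ler_wpM2l; lra.
  rewrite -mulrA; lra.
have x0 : 0 <= b ^+ 2 / 2 by rewrite divr_ge0 // sqr_ge0.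
(* Dividing by the ratio isolates the maximum, so its default value 0 and each [C] can be bounded
   separately. *)
rewrite mulrC -ler_pdivlMr; last first.
  by rewrite mulr_gt0 // divr_gt0 // exprn_gt0.
have S'0 : (0 < #|symdiff U (output n s)|)%N.
  by rewrite -(ltr0n R); apply: lt_le_trans (leS _ ck); apply: mulr_gt0.
apply: bigmax_le => [|C /eqP cC].
  apply: divr_ge0; first by rewrite divr_ge0 ?inner_weight_ge0.
  by apply: mulr_ge0 => //; apply: ltW.
rewrite ler_pdivlMr; last by rewrite mulr_gt0 // divr_gt0 // exprn_gt0.
by rewrite mulrC; apply: density_approx => //; [exact: leS|exact: leW].
Qed.
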